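(* Let $M$ be an o-minimal structure, let $G$ be a definably connected group $\emptyset$-definable in $M$, let $Z$ be a finite abelian group $\emptyset$-definable in $M$, and let $$0\longrightarrow Z \stackrel{\mu}{\longrightarrow} \widehat G \stackrel{\pi}{\longrightarrow} G \longrightarrow 1$$ be an abstract finite central extension. This extension is naturally interpretable in $M$ without parameters if and only if there is an $\emptyset$-definable 2-cocycle $f:G\times G\to Z$ such that $\widehat G$ and $G\times_f Z$ determine equivalent extensions. Moreover, this equivalence is given by a definable isomorphism whenever the group extension given by $\widehat G$ is $\emptyset$-definable.
   Context: An o-minimal structure expands a dense linear order without endpoints. A group is $\emptyset$-definable in $M$ if its underlying set and operation are definable in $M$ without parameters; it is definably connected if it has no proper definable subgroup of finite index. An abstract finite central extension is an exact sequence of abstract groups as displayed with $\mu(Z)$ central in $\widehat G$. Two central extensions $(\widehat G_1,\mu_1,\pi_1)$, $(\widehat G_2,\mu_2,\pi_2)$ of $G$ by $Z$ are equivalent if there is a group isomorphism $\gamma:\widehat G_1\to\widehat G_2$ with $\gamma\mu_1=\mu_2$ and $\pi_2\gamma=\pi_1$. The extension is naturally interpretable in $M$ without parameters if it is equivalent to a central extension $0\to Z\stackrel{\mu_0}{\to}\widehat G_0\stackrel{\pi_0}{\to}G\to1$ in which the group $\widehat G_0$ and the homomorphism $\pi_0$ are $\emptyset$-definable in $M$. A 2-cocycle (with $Z$ written additively) is a map $f:G\times G\to Z$ with $f(x,1)=0=f(1,x)$ and $f(x,y)+f(xy,z)=f(x,yz)+f(y,z)$. For a 2-cocycle $f$,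 $G\times_f Z$ is the group on $G\times Z$ with operation $(x_1,z_1)(x_2,z_2)=(x_1x_2,z_1+z_2+f(x_1,x_2))$; it is a central extension of $G$ by $Z$ via $z\mapsto(1,z)$ and the projection $(x,z)\mapsto x$. *)

(* Defs.v *)
From HB Require Import structures.
From mathcomp Require Import all_boot all_order all_algebra all_fingroup.
From mathcomp Require Import boolp classical_sets.

Set Implicit Arguments.
Unset Strict Implicit.
Unset Printing Implicit Defensive.

Import Order.TTheory.

Local Open Scope classical_set_scope.

(** * First-order structures expanding a linear order *)

(* The symbols that a structure interprets in addition to its order, which
   (like equality) is primitive in formulas. *)
Record language := Language {
  fsym : Type;
  rsym : Type;
  farity : fsym -> nat;
  rarity : rsym -> nat
}.

Record structure (d : Order.disp_t) (L : language) := Structure {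
  carrier :> orderType d;
  finterp : forall s : fsym L, ('I_(farity s) -> carrier) -> carrier;
  rinterp : forall s : rsym L, ('I_(rarity s) -> carrier) -> Prop
}.

(* Terms and formulas whose free variables are indexed by [V]; a quantifier
   binds the variable [None]. *)
Inductive term (L : language) (V : Type) : Type :=
| Var of V
| App (s : fsym L) of ('I_(farity s) -> term L V).

Inductive formula (L : language) (V : Type) : Type :=
| Equal of term L V & term L V
| Less of term L V & term L V
| Rel (s : rsym L) of ('I_(rarity s) -> term L V)
| Not of formula L V
| And of formula L V & formula L V
| Exists of formula L (option V).

Section Semantics.
Context {d : Order.disp_t} {L : language} (M : structure d L).

Fixpoint eval (V : Type) (e : V -> M) (t : term L V) : M :=
  match t with
  | Var v => e v
  | App s a => finterp (fun i => eval e (a i))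
  end.

Definition extend (V : Type) (e : V -> M) (a : M) (v : option V) : M :=
  if v is Some w then e w else a.

Fixpoint sat (V : Type) (e : V -> M) (phi : formula L V) {struct phi} : Prop :=
  match phi with
  | Equal t u => eval e t = eval e u
  | Less t u => (eval e t < eval e u)%O
  | Rel s a => rinterp (fun i => eval e (a i))
  | Not psi => ~ sat e psi
  | And psi chi => sat e psi /\ sat e chi
  | Exists psi => exists a : M, sat (extend e a) psi
  end.

Definition zdefinable (n : nat) (S : set ('I_n -> M)) : Prop :=
  exists phi : formula L 'I_n, forall x, S x <-> sat x phi.

(* A formula with [k] extra free variables, to be filled by the parameters. *)
Definition definable (n : nat) (S : set ('I_n -> M)) : Prop :=
  exists (k : nat) (a : 'I_k -> M) (phi : formula L ('I_n + 'I_k)),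
    forall x, S x <->
      sat (fun v => match v with inl i => x i | inr j => a j end) phi.

(* Closed, half-open and degenerate intervals are allowed here; each is a finite
   union of points and of open intervals with endpoints in M or infinite. *)
Definition o_minimal : Prop :=
  [/\ inhabited M,
      forall a b : M, (a < b)%O -> exists c : M, (a < c < b)%O,
      forall a : M, (exists b : M, (b < a)%O) /\ (exists b : M, (a < b)%O) &
      forall S : set M,
        definable [set x : 'I_1 -> M | S (x ord0)] ->
        exists s : seq (interval M), forall a, S a <-> has (fun i => a \in i) s].

(** * Sets and groups definable in a structure *)

(* [X] identified with a subset of M^n. *)
Record coding (X : Type) := Coding {
  cdim : nat;
  code : X -> 'I_cdim -> M;
  code_inj : injective code
}.
Arguments code {X} c x i.

Section Product.
Variables (X Y : Type) (cX : coding X) (cY : coding Y).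

Definition code_prod (p : X * Y) (i : 'I_(cdim cX + cdim cY)) : M :=
  match split i with
  | inl j => code cX p.1 j
  | inr k => code cY p.2 k
  end.

Lemma code_prod_inj : injective code_prod.
Proof.
move=> [x y] [x' y'] e; congr pair.
- apply: (@code_inj _ cX); apply/funext => j.
  by have := congr1 (fun F => F (unsplit (inl j))) e; rewrite /code_prod unsplitK.
- apply: (@code_inj _ cY); apply/funext => k.
  by have := congr1 (fun F => F (unsplit (inr k))) e; rewrite /code_prod unsplitK.
Qed.

Definition coding_prod : coding (X * Y) := Coding code_prod_inj.
End Product.

Definition zdefinable_in (X : Type) (cX : coding X) (S : set X) : Prop :=
  zdefinable (code cX @` S).

Definition definable_in (X : Type) (cX : coding X) (S : set X) : Prop :=
  definable (code cX @` S).

Definition graph (X Y : Type) (F : X -> Y) : set (X * Y) :=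
  [set p | p.2 = F p.1].

Definition zdefinable_fun (X Y : Type) (cX : coding X) (cY : coding Y)
    (F : X -> Y) : Prop :=
  zdefinable_in (coding_prod cX cY) (graph F).

Definition definable_fun (X Y : Type) (cX : coding X) (cY : coding Y)
    (F : X -> Y) : Prop :=
  definable_in (coding_prod cX cY) (graph F).

(* The underlying set and the binary operation are definable without
   parameters. *)
Definition zdefinable_law (X : Type) (cX : coding X) (op : X -> X -> X) : Prop :=
  zdefinable_in cX setT /\
  zdefinable_fun (coding_prod cX cX) cX (fun p => op p.1 p.2).

Definition zdefinable_group (G : groupType) (cG : coding G) : Prop :=
  zdefinable_law cG (fun x y => (x * y)%g).

Definition zdefinable_zmod (Z : zmodType) (cZ : coding Z) : Prop :=
  zdefinable_law cZ (fun x y => (x + y)%R).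

Definition subgroup (G : groupType) (H : set G) : Prop :=
  H 1%g /\ forall x y, H x -> H y -> H (x * y^-1)%g.

(* Finitely many left cosets cover the group. *)
Definition finite_index (G : groupType) (H : set G) : Prop :=
  exists s : seq G, forall x, exists2 y, y \in s & H (y^-1 * x)%g.

Definition definably_connected (G : groupType) (cG : coding G) : Prop :=
  forall H : set G, subgroup H -> definable_in cG H -> finite_index H -> H = setT.

End Semantics.

(** * Central extensions *)

Definition central_extension (Z : zmodType) (Gh G : groupType)
    (mu : Z -> Gh) (pi : Gh -> G) : Prop :=
  [/\ (forall z w, mu (z + w)%R = (mu z * mu w)%g) /\
      (forall x y, pi (x * y)%g = (pi x * pi y)%g),
      injective mu,
      forall y, exists x, pi x = y,
      forall x, pi x = 1%g <-> exists z, mu z = x &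
      forall z x, (mu z * x = x * mu z)%g].

Definition equivalence (Z : zmodType) (G Gh1 Gh2 : groupType)
    (mu1 : Z -> Gh1) (pi1 : Gh1 -> G) (mu2 : Z -> Gh2) (pi2 : Gh2 -> G)
    (gamma : Gh1 -> Gh2) : Prop :=
  [/\ forall x y, gamma (x * y)%g = (gamma x * gamma y)%g,
      bijective gamma,
      forall z, gamma (mu1 z) = mu2 z &
      forall x, pi2 (gamma x) = pi1 x].

Definition equivalent (Z : zmodType) (G Gh1 Gh2 : groupType)
    (mu1 : Z -> Gh1) (pi1 : Gh1 -> G) (mu2 : Z -> Gh2) (pi2 : Gh2 -> G) : Prop :=
  exists gamma : Gh1 -> Gh2, equivalence mu1 pi1 mu2 pi2 gamma.

Record cocycle (G : groupType) (Z : zmodType) := Cocycle {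
  cocycle_fun :> G -> G -> Z;
  cocycle1 : forall x, cocycle_fun x 1%g = 0%R /\ cocycle_fun 1%g x = 0%R;
  cocycleP : forall x y z,
    (cocycle_fun x y + cocycle_fun (x * y)%g z
     = cocycle_fun x (y * z)%g + cocycle_fun y z)%R
}.

(* The group written G x_f Z. *)
Definition twisted (G : groupType) (Z : zmodType) (f : cocycle G Z) : Type :=
  (G * Z)%type.

Section Twisted.
Variables (G : groupType) (Z : zmodType) (f : cocycle G Z).
Local Notation T := (twisted f).

Definition twisted_mul (p q : T) : T :=
  ((p.1 * q.1)%g, (p.2 + q.2 + f p.1 q.1)%R).
Definition twisted_one : T := (1%g, 0%R).
Definition twisted_inv (p : T) : T := ((p.1)^-1%g, (- p.2 - f (p.1)^-1%g p.1)%R).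

Let mulA : associative twisted_mul.
Proof.
move=> [x a] [y b] [z c]; rewrite /twisted_mul /= mulgA; congr pair.
have := cocycleP f x y z => e.
rewrite -!GRing.addrA; congr (_ + (_ + _))%R.
rewrite [(f x y + _)%R]GRing.addrCA e; congr (_ + _)%R.
exact: GRing.addrC.
Qed.

Let mul1 : left_id twisted_one twisted_mul.
Proof.
move=> [x a]; rewrite /twisted_mul /= mul1g (proj2 (cocycle1 f x)).
by rewrite GRing.add0r GRing.addr0.
Qed.

Let mulV : left_inverse twisted_one twisted_inv twisted_mul.
Proof.
move=> [x a]; rewrite /twisted_mul /= mulVg; congr pair.
by rewrite GRing.addrAC GRing.subrK GRing.addNr.
Qed.

Let mul1r : right_id twisted_one twisted_mul.
Proof.
move=> [x a]; rewrite /twisted_mul /= mulg1 (proj1 (cocycle1 f x)).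
by rewrite !GRing.addr0.
Qed.

Let mulVr : right_inverse twisted_one twisted_inv twisted_mul.
Proof.
move=> [x a]; rewrite /twisted_mul /= mulgV; congr pair.
have := cocycleP f x x^-1%g x.
rewrite mulgV mulVg (proj1 (cocycle1 f x)) (proj2 (cocycle1 f x)).
rewrite GRing.addr0 GRing.add0r => ->.
by rewrite GRing.addrA GRing.subrr GRing.add0r GRing.addNr.
Qed.

HB.instance Definition _ := Choice.copy T (G * Z)%type.
HB.instance Definition _ :=
  isGroup.Build T mulA mul1 mul1r mulV mulVr.

Definition twisted_in (z : Z) : T := (1%g, z).
Definition twisted_pr (p : T) : G := p.1.

Lemma twisted_central_extension : central_extension twisted_in twisted_pr.
Proof.
split.
- split=> // z w; congr pair; first by rewrite mulg1.
  by rewrite (proj1 (cocycle1 f _)) GRing.addr0.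
- by move=> z w [].
- by move=> y; exists (y, 0%R).
- move=> [x a]; split=> [/= e|[z [<- _]] //].
  by exists a; rewrite /twisted_in -e.
- move=> z [x a]; congr pair => /=; first by rewrite mulg1 mul1g.
  by rewrite (proj1 (cocycle1 f _)) (proj2 (cocycle1 f _)) [(z + a)%R]GRing.addrC.
Qed.
End Twisted.

Section Interpretability.
Context {d : Order.disp_t} {L : language} (M : structure d L).

Definition twisted_coding (G : groupType) (Z : zmodType)
    (cG : coding M G) (cZ : coding M Z) (f : cocycle G Z) : coding M (twisted f) :=
  coding_prod cG cZ.

Definition zdefinable_cocycle (G : groupType) (Z : zmodType)
    (cG : coding M G) (cZ : coding M Z) (f : cocycle G Z) : Prop :=
  zdefinable_fun (coding_prod cG cG) cZ (fun p => f p.1 p.2).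

(* Only the group and its projection to G are required to be definable; nothing
   is asked of the injection Z -> Gh. *)
Definition zdefinable_extension (G Gh : groupType)
    (cG : coding M G) (cGh : coding M Gh) (pi : Gh -> G) : Prop :=
  zdefinable_group cGh /\ zdefinable_fun cGh cG pi.

Definition naturally_interpretable (Z : zmodType) (G Gh : groupType)
    (cG : coding M G) (mu : Z -> Gh) (pi : Gh -> G) : Prop :=
  exists (Gh0 : groupType) (cGh0 : coding M Gh0)
         (mu0 : Z -> Gh0) (pi0 : Gh0 -> G),
    [/\ central_extension mu0 pi0,
        zdefinable_extension cG cGh0 pi0 &
        equivalent mu pi mu0 pi0].

End Interpretability.

(* Main.v *)
(** The fibres of a definable central extension by a finite group are finite,
    so the lexicographic order on M^n singles out a least element in each of
    them, giving a definable section [s] of the projection; the associated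
    cocycle is [s x * s y = mu (f x y) * s (x * y)].  The same order makes every
    element of a finite 0-definable set 0-definable, whence so is [mu], and
    therefore [f] and the isomorphism [mu z * s x |-> (x, z)]. *)
Require Import Defs.
From mathcomp Require Import all_boot all_order all_algebra all_fingroup.
From mathcomp Require Import boolp classical_sets.

Set Implicit Arguments.
Unset Strict Implicit.
Unset Printing Implicit Defensive.

Import Order.TTheory.

Local Open Scope classical_set_scope.

Local Arguments code {d L M X} c x i.

(** * Substitution of variables in formulas *)

Section Renaming.
Context {d : Order.disp_t} {L : language} (M : structure d L).

Fixpoint rename_term (V W : Type) (r : V -> W) (t : term L V) : term L W :=
  match t with
  | Var v => Var L (r v)
  | App s a => App (fun i => rename_term r (a i))
  end.

Fixpoint rename (V W : Type) (r : V -> W) (phi : formula L V) : formula L W :=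
  match phi with
  | Equal t u => Equal (rename_term r t) (rename_term r u)
  | Less t u => Less (rename_term r t) (rename_term r u)
  | Rel s a => Rel (fun i => rename_term r (a i))
  | Not psi => Not (rename r psi)
  | And psi chi => And (rename r psi) (rename r chi)
  | Exists psi => Exists (rename (omap r) psi)
  end.

Lemma eval_rename (V W : Type) (r : V -> W) (e : W -> M) t :
  eval e (rename_term r t) = eval (e \o r) t.
Proof. by elim: t => //= s a IH; congr finterp; apply/funext. Qed.

Lemma extend_omap (V W : Type) (r : V -> W) (e : W -> M) a :
  extend e a \o omap r = extend (e \o r) a.
Proof. by apply/funext; case. Qed.

Lemma sat_rename V (phi : formula L V) :
  forall W (r : V -> W) (e : W -> M),
  sat e (rename r phi) <-> sat (e \o r) phi.
Proof.
elim: {V} phi => [V t u|V t u|V s a|V psi IH|V psi IH chi IH'|V psi IH] W r e /=.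
- by rewrite !eval_rename.
- by rewrite !eval_rename.
- by under eq_fun do rewrite eval_rename.
- by rewrite IH.
- by rewrite IH IH'.
- by split=> -[a]; [rewrite IH extend_omap|rewrite -extend_omap -IH] => h;
     exists a.
Qed.
End Renaming.

(** * Boolean operations and projections of parameter-free definable sets *)

Section DefinableSets.
Context {d : Order.disp_t} {L : language} (M : structure d L).

(** At [V := 'I_n] this is convertible to [zdefinable]. Arbitrary variable types are allowed because
    a quantifier passes to [option V], and a block of [n] quantifiers to [V + 'I_n]. *)
Definition expressible (V : Type) (S : set (V -> M)) : Prop :=
  exists phi : formula L V, forall x, S x <-> sat x phi.

Lemma expressible_ext (V : Type) (S T : set (V -> M)) :
  (forall x, S x <-> T x) -> expressible S -> expressible T.
Proof. by move=> ST [phi h]; exists phi => x; rewrite -ST. Qed.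

Lemma expressible_sub (V W : Type) (r : V -> W) (S : set (V -> M)) :
  expressible S -> expressible (fun e : W -> M => S (fun v => e (r v))).
Proof. by case=> phi h; exists (rename r phi) => e; rewrite sat_rename. Qed.

Lemma expressible_not (V : Type) (S : set (V -> M)) :
  expressible S -> expressible (fun e => ~ S e).
Proof. by case=> phi h; exists (Not phi) => e /=; rewrite h. Qed.

Lemma expressible_and (V : Type) (S T : set (V -> M)) :
  expressible S -> expressible T -> expressible (fun e => S e /\ T e).
Proof.
by case=> phi h [psi h']; exists (And phi psi) => e /=; rewrite h h'.
Qed.

Lemma expressible_or (V : Type) (S T : set (V -> M)) :
  expressible S -> expressible T -> expressible (fun e => S e \/ T e).
Proof.
move=> hS hT.
apply: (@expressible_ext _ (fun e => ~ (~ S e /\ ~ T e))); last first.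
  by apply/expressible_not/expressible_and; apply/expressible_not.
by move=> e; rewrite not_andP !notK.
Qed.

(** Irreflexivity of the order makes [exists a, a < a] false, and this sentence is available even
    when [V] is empty. *)
Lemma expressible_False (V : Type) : expressible (fun _ : V -> M => False).
Proof.
exists (Exists (Less (Var L None) (Var L None))) => e /=.
by split=> // -[a]; rewrite ltxx.
Qed.

Lemma expressible_has (V : Type) (I : eqType) (s : seq I)
    (S : I -> set (V -> M)) :
  (forall i, expressible (S i)) ->
  expressible (fun e => exists2 i, i \in s & S i e).
Proof.
move=> hS; elim: s => [|i s IH].
  by apply: expressible_ext (expressible_False V) => e; split=> // -[].
apply: expressible_ext (expressible_or (hS i) IH) => e; split.
  case=> [h|[j js h]]; [exists i|exists j] => //; first exact: mem_head.
  by rewrite inE js orbT.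
case=> j; rewrite inE => /predU1P[-> h|js h]; first by left.
by right; exists j.
Qed.

Lemma expressible_all (V : Type) (I : eqType) (s : seq I)
    (S : I -> set (V -> M)) :
  (forall i, expressible (S i)) ->
  expressible (fun e => forall i, i \in s -> S i e).
Proof.
move=> hS; have hN i := expressible_not (hS i).
apply: expressible_ext (expressible_not (expressible_has s hN)) => e; split.
  by move=> h i si; apply: contrapT => hi; apply: h; exists i.
by move=> h [i si]; apply; apply: h.
Qed.

Lemma expressible_ex1 (V : Type) (S : set (option V -> M)) :
  expressible S -> expressible (fun e => exists a, S (extend e a)).
Proof. by case=> phi h; exists (Exists phi) => e /=; split=> -[a /h]; exists a. Qed.

(** A block of [n] quantifiers is [n] single ones: by induction on [n], the coordinate [ord0]
    becomes the bound variable [None] and the remaining coordinates form the shorter block. *)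
Lemma expressible_ex (V : Type) n (S : (V -> M) -> ('I_n -> M) -> Prop) :
  expressible (fun e : V + 'I_n -> M =>
                 S (fun v => e (inl v)) (fun i => e (inr i))) ->
  expressible (fun e => exists a, S e a).
Proof.
elim: n V S => [|n IH] V S hS.
  pose r (v : V + 'I_0) : V :=
    match v with inl w => w | inr i => False_rect V (notF (ltn_ord i)) end.
  apply: expressible_ext (expressible_sub r hS) => e; split=> [h|[a]].
    by eexists; exact: h.
  by have <- : (fun i => e (r (inr i))) = a by apply/funext; case.
(* The [n.+1]-tuple is reassembled from its entry at [ord0], stored as [e None], and its tail [a];
   [unlift ord0] tells the two apart. *)
pose T (e : option V -> M) (a : 'I_n -> M) :=
  S (fun v => e (Some v)) (fun i => oapp a (e None) (unlift ord0 i)).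
pose r (v : V + 'I_n.+1) : option V + 'I_n :=
  match v with
  | inl w => inl (Some w)
  | inr i => oapp inr (inl None) (unlift ord0 i)
  end.
have /IH/expressible_ex1 hT : expressible (fun e : option V + 'I_n -> M =>
    T (fun v => e (inl v)) (fun i => e (inr i))).
  apply: expressible_ext (expressible_sub r hS) => e; rewrite /T.
  have -> // : (fun i => e (r (inr i))) =
               (fun i => oapp (fun j => e (inr j)) (e (inl None)) (unlift ord0 i)).
  by apply/funext => i /=; case: (unlift ord0 i).
apply: expressible_ext hT => e; split=> [[a [b h]]|[a h]].
  by eexists; exact: h.
exists (a ord0), (fun i => a (lift ord0 i)); rewrite /T /=.
have -> // : (fun i => oapp (fun i => a (lift ord0 i)) (a ord0) (unlift ord0 i)) = a.
by apply/funext => i; case: unliftP => [j|] ->.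
Qed.

Lemma expressible_lt (V : Type) (v w : V) :
  expressible (fun e : V -> M => (e v < e w)%O).
Proof. by exists (Less (Var L v) (Var L w)). Qed.

Lemma expressible_eq (V : Type) (v w : V) :
  expressible (fun e : V -> M => e v = e w).
Proof. by exists (Equal (Var L v) (Var L w)). Qed.

(** The body copies [code_prod], so the code of a pair is convertible to the [join] of the codes of
    its components. *)
Definition join m n (u : 'I_m -> M) (v : 'I_n -> M) (i : 'I_(m + n)) : M :=
  match split i with inl j => u j | inr k => v k end.

Lemma join_lshift m n (u : 'I_m -> M) (v : 'I_n -> M) i :
  join u v (lshift n i) = u i.
Proof. by rewrite /join -[lshift n i]/(unsplit (inl i)) unsplitK. Qed.

Lemma join_rshift m n (u : 'I_m -> M) (v : 'I_n -> M) i :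
  join u v (rshift m i) = v i.
Proof. by rewrite /join -[rshift m i]/(unsplit (inr i)) unsplitK. Qed.

Lemma joinE m n (e : 'I_(m + n) -> M) :
  e = join (fun i => e (lshift n i)) (fun i => e (rshift m i)).
Proof.
by apply/funext => i; rewrite /join -{1}(splitK i); case: (split i).
Qed.

Lemma join_inj m n (u u' : 'I_m -> M) (v v' : 'I_n -> M) :
  join u v = join u' v' -> u = u' /\ v = v'.
Proof.
move=> e; split; apply/funext => i.
  by rewrite -(join_lshift u v) e join_lshift.
by rewrite -(join_rshift u v) e join_rshift.
Qed.

(** The maps [r] and [r'] pick the variables that fill the two blocks; below they rearrange
    coordinates when graphs are combined. *)
Lemma expressible_join (V : Type) m n (r : 'I_m -> V) (r' : 'I_n -> V)
    (S : set ('I_(m + n) -> M)) :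
  expressible S ->
  expressible (fun e : V -> M => S (join (fun i => e (r i)) (fun i => e (r' i)))).
Proof.
move=> /(expressible_sub
  (fun i => match split i with inl j => r j | inr k => r' k end)).
apply: expressible_ext => e.
set u := (X in S X); set v := (X in _ <-> S X).
by have -> : u = v by apply/funext => i; rewrite /u /v /join; case: split.
Qed.

Lemma expressible_eqv (V : Type) n (r r' : 'I_n -> V) :
  expressible (fun e : V -> M => (fun i => e (r i)) = (fun i => e (r' i))).
Proof.
apply: expressible_ext (expressible_all (enum 'I_n)
  (fun i => expressible_eq (r i) (r' i))) => e; split=> [h|h i _].
  by apply/funext => i; apply: h; rewrite mem_enum.
by have := congr1 (@^~ i) h.
Qed.

End DefinableSets.

(** * Definability of subsets of coded sets and of functions between them *)

Section CodedSets.
Context {d : Order.disp_t} {L : language} (M : structure d L).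

Section Predicates.
Variables (X : Type) (cX : coding M X).
Implicit Types P Q : set X.

Lemma codeI x y : code cX x = code cX y -> x = y.
Proof. exact: code_inj. Qed.

Lemma image_codeE P x : (code cX @` P) (code cX x) <-> P x.
Proof. by split=> [[y Py /codeI <-]|Px]; last exists x. Qed.

Lemma zdefinable_in_ext P Q :
  (forall x, P x <-> Q x) -> zdefinable_in cX P -> zdefinable_in cX Q.
Proof. by move=> PQ; have -> : P = Q by apply/funext => x; apply/propext. Qed.

Lemma zdefinable_in_and P Q : zdefinable_in cX P -> zdefinable_in cX Q ->
  zdefinable_in cX (fun x => P x /\ Q x).
Proof.
move=> hP hQ; apply: expressible_ext (expressible_and hP hQ) => e; split.
  by move=> [[x Px <-]] /image_codeE Qx; exists x.
by move=> [x [Px Qx] <-]; split; exists x.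
Qed.

Lemma zdefinable_in_or P Q : zdefinable_in cX P -> zdefinable_in cX Q ->
  zdefinable_in cX (fun x => P x \/ Q x).
Proof.
move=> hP hQ; apply: expressible_ext (expressible_or hP hQ) => e; split.
  by case=> -[x Px <-]; exists x => //; [left|right].
by move=> [x [Px|Qx] <-]; [left|right]; exists x.
Qed.

(** The complement taken in the power of [M] also contains points that code nothing, so it is
    intersected with the set of all codes. *)
Lemma zdefinable_in_not P : zdefinable_in cX setT -> zdefinable_in cX P ->
  zdefinable_in cX (fun x => ~ P x).
Proof.
move=> hT hP.
apply: expressible_ext (expressible_and hT (expressible_not hP)) => e; split.
  by move=> [[x _ <-]] hx; exists x => // Px; apply: hx; exists x.
by move=> [x Px <-]; split; [exists x|rewrite image_codeE].
Qed.

Lemma zdefinable_in_has (I : eqType) (s : seq I) (P : I -> set X) :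
  (forall i, zdefinable_in cX (P i)) ->
  zdefinable_in cX (fun x => exists2 i, i \in s & P i x).
Proof.
move=> hP; apply: expressible_ext (expressible_has s hP) => e; split.
  by move=> [i si [x Px <-]]; exists x => //; exists i.
by move=> [x [i si Px] <-]; exists i => //; exists x.
Qed.
End Predicates.

Section Products.
Variables (G X : Type) (cG : coding M G) (cX : coding M X).

Lemma image_code_joinE (P : set (G * X)) u v :
  (code (coding_prod cG cX) @` P) (join u v) <->
  exists g x, [/\ P (g, x), code cG g = u & code cX x = v].
Proof.
split=> [[[g x] Pgx /join_inj[<- <-]]|[g [x [Pgx <- <-]]]].
  by exists g, x.
by exists (g, x).
Qed.

Lemma image_code_graphE (a : G -> X) u v :
  (code (coding_prod cG cX) @` graph a) (join u v) <->
  exists2 g, code cG g = u & code cX (a g) = v.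
Proof.
rewrite image_code_joinE; split=> [[g [x [xE <- <-]]]|[g <- <-]].
  by exists g; rewrite // [x]xE.
by exists g, (a g).
Qed.

Lemma zdefinable_in_setT_prod : zdefinable_in cG setT -> zdefinable_in cX setT ->
  zdefinable_in (coding_prod cG cX) setT.
Proof.
move=> hG hX; apply: expressible_ext (expressible_and
  (expressible_sub (lshift _) hG) (expressible_sub (@rshift _ _) hX)) => e.
rewrite [X in _ <-> _ X]joinE image_code_joinE.
split=> [[[g _ <-] [x _ <-]]|[g [x [_ <- <-]]]]; first by exists g, x.
by split; [exists g|exists x].
Qed.

Lemma zdefinable_in_ex (P : G -> X -> Prop) :
  zdefinable_in (coding_prod cG cX) (fun p => P p.1 p.2) ->
  zdefinable_in cG (fun g => exists x, P g x).
Proof.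
move=> hP; apply: expressible_ext (expressible_ex
  (S := fun e v => (code (coding_prod cG cX) @` (fun p => P p.1 p.2)) (join e v))
  (expressible_join _ _ hP)) => e.
split=> [[v /image_code_joinE[g [x [Px <- _]]]]|[g [x Px] <-]].
  by exists g => //; exists x.
by exists (code cX x); apply/image_code_joinE; exists g, x.
Qed.


(** The preimage is a projection: some [v] satisfies [P] and lies on the graph of [a] above [g]. *)
Lemma zdefinable_in_comp (P : set X) (a : G -> X) :
  zdefinable_in cX P -> zdefinable_fun cG cX a ->
  zdefinable_in cG (fun g => P (a g)).
Proof.
move=> hP ha; apply: expressible_ext (expressible_ex
  (S := fun e v => (code (coding_prod cG cX) @` graph a) (join e v) /\
                   (code cX @` P) v)
  (expressible_and (expressible_join _ _ ha) (expressible_sub _ hP))) => e.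
split=> [[v [/image_code_graphE[g <- <-] /image_codeE Pg]]|[g Pg <-]].
  by exists g.
exists (code cX (a g)); split; last by exists (a g).
by apply/image_code_graphE; exists g.
Qed.

End Products.

Section Functions.
Variables (G X Y : Type) (cG : coding M G) (cX : coding M X) (cY : coding M Y).

Lemma zdefinable_fun_pair (a : G -> X) (b : G -> Y) :
  zdefinable_fun cG cX a -> zdefinable_fun cG cY b ->
  zdefinable_fun cG (coding_prod cX cY) (fun g => (a g, b g)).
Proof.
move=> ha hb.
apply: expressible_ext (expressible_and
  (expressible_join (fun i => lshift _ i) (fun i => rshift _ (lshift _ i)) ha)
  (expressible_join (fun i => lshift _ i) (fun i => rshift _ (rshift _ i)) hb)) => e.
rewrite [X in _ <-> _ X]joinE [X in _ <-> _ (join _ X)]joinE.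
split=> [[/image_code_graphE[g gu gx] /image_code_graphE[h]]|].
  rewrite -gu => /(@codeI _ cG)-> hy; apply/image_code_graphE.
  by exists g => //; rewrite -gx -hy.
by case/image_code_graphE=> g gu /join_inj[gx gy]; split; apply/image_code_graphE;
  exists g.
Qed.

Lemma zdefinable_fun_comp (F : X -> Y) (a : G -> X) :
  zdefinable_fun cX cY F -> zdefinable_fun cG cX a ->
  zdefinable_fun cG cY (fun g => F (a g)).
Proof.
move=> hF ha; apply: expressible_ext (expressible_ex
  (S := fun e v =>
     (code (coding_prod cG cX) @` graph a) (join (fun i => e (lshift _ i)) v) /\
     (code (coding_prod cX cY) @` graph F) (join v (fun i => e (rshift _ i))))
  (expressible_and (expressible_join _ _ ha) (expressible_join _ _ hF))) => e.
rewrite [X in _ <-> _ X]joinE image_code_graphE; split.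
  case=> v [/image_code_graphE[g <- <-] /image_code_graphE[x /(@codeI _ cX)-> <-]].
  by exists g.
case=> g gu gv; exists (code cX (a g)); split; apply/image_code_graphE.
  by exists g.
by exists (a g).
Qed.

Lemma zdefinable_fun_fst (a : G -> X * Y) :
  zdefinable_fun cG (coding_prod cX cY) a ->
  zdefinable_fun cG cX (fun g => (a g).1).
Proof.
move=> ha; apply: expressible_ext (expressible_ex
  (S := fun e v => (code (coding_prod cG (coding_prod cX cY)) @` graph a)
     (join (fun i => e (lshift _ i)) (join (fun i => e (rshift _ i)) v)))
  _) => [e|].
  rewrite [X in _ <-> _ X]joinE image_code_graphE; split.
    by case=> v /image_code_graphE[g <- /join_inj[<- _]]; exists g.
  case=> g gu gv; exists (code cY (a g).2); apply/image_code_graphE.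
  by exists g; rewrite // -gv.
(* The code of [(g, (x, y))] is regrouped: [g] and [x] are read from the free variables, and [y]
   from the quantified block. *)
apply: expressible_ext (expressible_join (fun i => inl (lshift _ i))
  (fun i => match split i with inl j => inl (rshift _ j) | inr k => inr k end)
  ha) => e.
set u := (X in _ (join _ X)); set v := (X in _ <-> _ (join _ X)).
by have -> : u = v by apply/funext => i; rewrite /u /v /join; case: split.
Qed.

Lemma zdefinable_fun_snd (a : G -> X * Y) :
  zdefinable_fun cG (coding_prod cX cY) a ->
  zdefinable_fun cG cY (fun g => (a g).2).
Proof.
move=> ha; apply: expressible_ext (expressible_ex
  (S := fun e v => (code (coding_prod cG (coding_prod cX cY)) @` graph a)
     (join (fun i => e (lshift _ i)) (join v (fun i => e (rshift _ i)))))
  _) => [e|].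
  rewrite [X in _ <-> _ X]joinE image_code_graphE; split.
    by case=> v /image_code_graphE[g <- /join_inj[_ <-]]; exists g.
  case=> g gu gv; exists (code cX (a g).1); apply/image_code_graphE.
  by exists g; rewrite // -gv.
apply: expressible_ext (expressible_join (fun i => inl (lshift _ i))
  (fun i => match split i with inl j => inr j | inr k => inl (rshift _ k) end)
  ha) => e.
set u := (X in _ (join _ X)); set v := (X in _ <-> _ (join _ X)).
by have -> : u = v by apply/funext => i; rewrite /u /v /join; case: split.
Qed.

Lemma zdefinable_fun_id : zdefinable_in cG setT -> zdefinable_fun cG cG id.
Proof.
move=> hG; apply: expressible_ext (expressible_and
  (expressible_sub (lshift _) hG)
  (expressible_eqv M (lshift _) (@rshift _ _))) => e.
rewrite [X in _ <-> _ X]joinE image_code_graphE.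
by split=> [[[g _ gu] <-]|[g gu gv]]; [exists g|split; [exists g|rewrite -gu]].
Qed.

Lemma zdefinable_in_eq (a b : G -> X) :
  zdefinable_fun cG cX a -> zdefinable_fun cG cX b ->
  zdefinable_in cG (fun g => a g = b g).
Proof.
move=> ha hb; apply: expressible_ext (expressible_ex
  (S := fun e v => (code (coding_prod cG cX) @` graph a) (join e v) /\
                   (code (coding_prod cG cX) @` graph b) (join e v))
  (expressible_and (expressible_join _ _ ha) (expressible_join _ _ hb))) => e.
split; last first.
  by case=> g ab <-; exists (code cX (a g)); split; apply/image_code_graphE;
     exists g => //; rewrite ab.
case=> v [/image_code_graphE[g <- <-] /image_code_graphE[h /(@codeI _ cG)-> hg]].
by exists g => //; apply/esym/(codeI hg).
Qed.

(** Packing the code as a [tuplelexi] gives [X] the total lexicographic order inherited from [M]. *)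
Definition key (x : X) : (cdim cX).-tuplelexi M := [tuple code cX x i | i < cdim cX].

(** Since the dimension is fixed, the lexicographic order is a finite disjunction over the first
    coordinate [k] where the two tuples differ. *)
Lemma zdefinable_in_lt (a b : G -> X) :
  zdefinable_fun cG cX a -> zdefinable_fun cG cX b ->
  zdefinable_in cG (fun g => (key (a g) < key (b g))%O).
Proof.
move=> ha hb; pose lt (u v : 'I_(cdim cX) -> M) :=
  exists2 k : 'I_(cdim cX), k \in enum 'I_(cdim cX) &
    (u k < v k)%O /\
    forall i, i \in [seq i : 'I_(cdim cX) <- enum 'I_(cdim cX) | (i < k)%N] -> u i = v i.
have ltP x y : (key x < key y)%O <-> lt (code cX x) (code cX y).
  split=> [/ltxi_tuplePlt[k kE klt]|[k _ [klt kE]]].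
    exists k; rewrite ?mem_enum //; move: klt; rewrite !tnth_mktuple; split=> // i.
    by rewrite mem_filter => /andP[/kE]; rewrite !tnth_mktuple.
  apply/ltxi_tuplePlt; exists k => [i ik|]; rewrite !tnth_mktuple //.
  by apply: kE; rewrite mem_filter ik mem_enum.
pose S (e : 'I_(cdim cG) -> M) (w : 'I_(cdim cX + cdim cX) -> M) :=
  ((code (coding_prod cG cX) @` graph a) (join e (fun i => w (lshift _ i))) /\
      (code (coding_prod cG cX) @` graph b) (join e (fun i => w (rshift _ i)))) /\
   lt (fun i => w (lshift _ i)) (fun i => w (rshift _ i)).
apply: expressible_ext (expressible_ex (S := S) _) => [e|].
  split=> [[w [[/image_code_graphE[g <- <-]]]]|[g /ltP gab <-]].
    by move=> /image_code_graphE[h /(@codeI _ cG)-> <-] /ltP; exists g.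
  exists (join (code cX (a g)) (code cX (b g))); rewrite /S.
  under eq_fun do rewrite join_lshift.
  rewrite (_ : (fun i => join _ _ (rshift _ i)) = code cX (b g)).
    by split; first by split; apply/image_code_graphE; exists g.
  by apply/funext => i; rewrite join_rshift.
apply: expressible_and.
  apply: expressible_and.
    exact: (expressible_join (fun i => inl i) (fun i => inr (lshift _ i)) ha).
  exact: (expressible_join (fun i => inl i) (fun i => inr (rshift _ i)) hb).
apply: expressible_has => k; apply: expressible_and; first exact: expressible_lt.
by apply: expressible_all => i; apply: expressible_eq.
Qed.

End Functions.
End CodedSets.

(** * Elements of finite definable sets *)

Section FiniteSets.
Context {d : Order.disp_t} {L : language} (M : structure d L).

Lemma key_inj (X : Type) (cX : coding M X) : injective (key cX).
Proof.
move=> x y e; apply: (@codeI _ _ _ _ cX); apply/funext => i.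
by have := congr1 (fun t => tnth t i) e; rewrite !tnth_mktuple.
Qed.

Lemma exists_minimum (X : eqType) (disp : Order.disp_t) (T : orderType disp)
    (f : X -> T) (s : seq X) (x0 : X) : x0 \in s ->
  exists2 m, m \in s & forall y, y \in s -> (f m <= f y)%O.
Proof.
elim: s x0 => // a s IH x0 _; case: s => [|b s] in IH *.
  by exists a; rewrite ?mem_head // => y; rewrite inE => /eqP->.
have [m ms mmin] := IH b (mem_head _ _).
have [am|ma] := leP (f a) (f m).
  exists a => [|y]; first exact: mem_head.
  by rewrite inE => /predU1P[->|/mmin] //; apply: le_trans.
exists m => [|y]; first by rewrite inE ms orbT.
by rewrite inE => /predU1P[->|/mmin] //; apply: ltW.
Qed.

(** Induction on the length of the list: its least element is definable as the member with none
    below it. Either [x] is that element, or it survives in the definable set left after deleting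
    it. *)
Lemma zdefinable_in_elem (X : eqType) (cX : coding M X) (s : seq X) (x : X) :
  zdefinable_in cX setT -> zdefinable_in cX (fun y => y \in s) -> x \in s ->
  zdefinable_in cX (fun y => y = x).
Proof.
move=> hX; have [n] := ubnP (size s); elim: n s => // n IH s sn hs xs.
have [m ms mmin] := exists_minimum (key cX) xs.
have hm : zdefinable_in cX (fun y => y = m).
  apply: (@zdefinable_in_ext _ _ _ _ _ (fun y => y \in s /\
    ~ exists z, z \in s /\ (key cX z < key cX y)%O)) => [y|].
    split=> [[ys ny]|->]; last first.
      by split=> // -[z [/mmin]]; rewrite leNgt => /negP.
    apply: (@key_inj _ cX); apply/eqP; rewrite eq_le mmin // andbT leNgt.
    by apply/negP => h; apply: ny; exists m.
  apply: zdefinable_in_and => //; apply: zdefinable_in_not => //.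
  (* The identity on pairs [(y, z)] is definable, and its two projections then serve as the
     variables [y] and [z]. The same device replaces explicit formulas in the later proofs. *)
  have hid := zdefinable_fun_id (zdefinable_in_setT_prod hX hX).
  apply: zdefinable_in_ex; apply: zdefinable_in_and.
    exact: zdefinable_in_comp hs (zdefinable_fun_snd hid).
  exact: zdefinable_in_lt (zdefinable_fun_snd hid) (zdefinable_fun_fst hid).
have [->//|xm] := eqVneq x m.
apply: (IH [seq y <- s | y != m]); last by rewrite mem_filter xm.
  (* Filtering strictly shortens the list because [m] itself fails the test. *)
  rewrite size_filter (leq_trans _ (ltnSE sn)) // ltn_neqAle count_size andbT.
  by rewrite -all_count; apply/negP => /allP/(_ m ms) /=; rewrite eqxx.
apply: (@zdefinable_in_ext _ _ _ _ _ (fun y => y \in s /\ ~ y = m)) => [y|].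
  by rewrite mem_filter; split=> [[-> /eqP->]|/andP[/eqP]].
by apply: zdefinable_in_and => //; apply: zdefinable_in_not.
Qed.
End FiniteSets.

(** * Cocycles and equivalences from sections of a central extension *)

Section CentralExtensions.
Variables (Z : zmodType) (E G : groupType) (mu : Z -> E) (pi : E -> G).
Hypothesis hE : central_extension mu pi.
Local Open Scope group_scope.

Let muD z w : mu (z + w)%R = mu z * mu w. Proof. by case: hE => -[]. Qed.
Let piM x y : pi (x * y) = pi x * pi y. Proof. by case: hE => -[]. Qed.
Let mu_inj : injective mu. Proof. by case: hE. Qed.
Let muC z x : mu z * x = x * mu z. Proof. by case: hE. Qed.

Lemma extension_pi1 : pi 1 = 1.
Proof. by apply: (@mulgI _ (pi 1)); rewrite -piM !mulg1. Qed.

Lemma extension_mu0 : mu 0%R = 1.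
Proof. by apply: (@mulgI _ (mu 0%R)); rewrite -muD GRing.addr0 mulg1. Qed.

Lemma extension_pi_mu z : pi (mu z) = 1.
Proof. by case: hE => _ _ _ h _; apply/h; exists z. Qed.

Lemma extension_fiber x y : pi x = pi y -> exists z, mu z * y = x.
Proof.
move=> xy; have [_ _ _ kerP _] := hE.
have /kerP[z zE] : pi (x * y^-1) = 1 by rewrite piM xy -piM mulgV extension_pi1.
by exists z; rewrite zE mulgVK.
Qed.

Variable s : G -> E.
Hypotheses (sK : forall x, pi (s x) = x) (s1 : s 1 = 1).

(** The elements [s x * s y] and [s (x * y)] lie in one fibre, so they differ by a unique central
    factor. Its normalization comes from [s 1 = 1], and the cocycle identity from associativity. *)
Lemma section_cocycle : exists f : cocycle G Z,
  forall x y, mu (f x y) * s (x * y) = s x * s y.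
Proof.
have /choice[f fE] : forall p : G * G, exists z,
    mu z * s (p.1 * p.2) = s p.1 * s p.2.
  by move=> p; apply: extension_fiber; rewrite piM !sK.
have f1 x : f (x, 1) = 0%R /\ f (1, x) = 0%R.
  split; apply/mu_inj/(@mulIg _ (s x)); rewrite extension_mu0 mul1g.
    by have := fE (x, 1); rewrite /= s1 !mulg1.
  by have := fE (1, x); rewrite /= s1 !mul1g.
have fM x y : mu (f (x, y)) * s (x * y) = s x * s y by exact: fE (x, y).
have fP x y z : (f (x, y) + f ((x * y)%g, z) = f (x, (y * z)%g) + f (y, z))%R.
  (* After multiplication by [s (x * y * z)], both sides collapse to [s x * s y * s z]; on the right
     this needs the centrality of [mu]. *)
  apply/mu_inj/(@mulIg _ (s (x * y * z))); rewrite !muD.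
  transitivity (s x * s y * s z).
    by rewrite -[LHS]mulgA fM [LHS]mulgA fM.
  rewrite [mu (f (x, _)) * _]muC -[RHS]mulgA -(mulgA x) fM.
  by rewrite [RHS]mulgA [mu _ * _]muC -[RHS]mulgA fM mulgA.
by exists (Cocycle f1 fP) => x y; apply: fM.
Qed.

(** Every [g] factors uniquely as [mu z * s (pi g)], and [gamma] reads off the two factors. The
    second conclusion describes its graph by an equation, from which its definability will
    follow. *)
Lemma section_equivalence (f : cocycle G Z) :
  (forall x y, mu (f x y) * s (x * y) = s x * s y) ->
  exists2 gamma : E -> twisted f,
    equivalence mu pi (twisted_in f) (twisted_pr (f := f)) gamma &
    forall g p, p = gamma g <-> mu p.2 * s p.1 = g.
Proof.
move=> fE.
have /choice[zeta zE] : forall g, exists z, mu z * s (pi g) = g.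
  by move=> g; apply: extension_fiber; rewrite sK.
pose gamma g : twisted f := (pi g, zeta g).
have gammaP g (p : twisted f) : p = gamma g <-> mu p.2 * s p.1 = g.
  split=> [->|<-]; first exact: zE.
  have e : pi (mu p.2 * s p.1) = p.1 by rewrite piM extension_pi_mu mul1g sK.
  rewrite /gamma e; case: p e => x z /= e; congr pair.
  by apply/mu_inj/(@mulIg _ (s x)); rewrite -[LHS]zE e.
exists gamma => //; split=> //.
- move=> g h; apply/esym/gammaP => /=.
  rewrite !muD -[LHS]mulgA fE mulgA -(mulgA (mu (zeta g))) (muC (zeta h)).
  by rewrite [mu (zeta g) * _]mulgA zE -mulgA zE.
- exists (fun p => mu p.2 * s p.1) => [g|p]; first exact/gammaP.
  exact/esym/gammaP.
- by move=> z; apply/esym/gammaP; rewrite /= s1 mulg1.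
Qed.
End CentralExtensions.

Lemma equivalent_trans (Z : zmodType) (G E1 E2 E3 : groupType)
    (mu1 : Z -> E1) (pi1 : E1 -> G) (mu2 : Z -> E2) (pi2 : E2 -> G)
    (mu3 : Z -> E3) (pi3 : E3 -> G) :
  equivalent mu1 pi1 mu2 pi2 -> equivalent mu2 pi2 mu3 pi3 ->
  equivalent mu1 pi1 mu3 pi3.
Proof.
move=> [g [gM gb gmu gpi]] [h [hM hb hmu hpi]]; exists (h \o g); split=> /=.
- by move=> x y; rewrite gM hM.
- exact: bij_comp.
- by move=> z; rewrite gmu hmu.
- by move=> x; rewrite hpi gpi.
Qed.

(** * Definable sections, cocycles and twisted products *)

Section DefinableExtensions.
Context {d : Order.disp_t} {L : language} (M : structure d L).
Local Open Scope group_scope.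

Lemma definable_zdefinable n (S : set ('I_n -> M)) : zdefinable S -> definable S.
Proof.
move=> [phi h]; exists 0, (fun i : 'I_0 => False_rect _ (notF (ltn_ord i))), (rename inl phi).
by move=> x; rewrite h sat_rename.
Qed.

(** Functions produced by [choice] come with no formula; they are definable once a definable
    relation determines their values. *)
Lemma zdefinable_fun_graph (X Y : Type) (cX : coding M X) (cY : coding M Y)
    (F : X -> Y) (R : X -> Y -> Prop) :
  (forall x y, R x y <-> y = F x) ->
  zdefinable_in (coding_prod cX cY) (fun p => R p.1 p.2) ->
  zdefinable_fun cX cY F.
Proof. by move=> RF; apply: zdefinable_in_ext => p; apply: RF. Qed.

Section Law.
Variables (X : Type) (cX : coding M X) (op : X -> X -> X).
Hypothesis hX : zdefinable_law cX op.

Lemma zdefinable_fun_law (Y : Type) (cY : coding M Y) (a b : Y -> X) :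
  zdefinable_fun cY cX a -> zdefinable_fun cY cX b ->
  zdefinable_fun cY cX (fun y => op (a y) (b y)).
Proof.
move=> ha hb.
exact: (zdefinable_fun_comp (proj2 hX) (zdefinable_fun_pair ha hb)).
Qed.
End Law.

(** The identity is the only idempotent of a group, which defines it from multiplication alone. *)
Lemma zdefinable_in1 (G : groupType) (cG : coding M G) :
  zdefinable_group cG -> zdefinable_in cG (fun x => x = 1).
Proof.
move=> hG; have hid := zdefinable_fun_id (proj1 hG).
apply: (@zdefinable_in_ext _ _ _ _ _ (fun x => x * x = x)) => [x|].
  split=> [e|->]; last exact: mulg1.
  by apply: (@mulgI _ x); rewrite e mulg1.
exact: zdefinable_in_eq (zdefinable_fun_law hG hid hid) hid.
Qed.

Variables (G : groupType) (cG : coding M G) (hG : zdefinable_group cG).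
Variables (Z : finZmodType) (cZ : coding M Z) (hZ : zdefinable_zmod cZ).
Variables (E : groupType) (cE : coding M E) (mu : Z -> E) (pi : E -> G).
Hypotheses (hE : central_extension mu pi) (hD : zdefinable_extension cG cE pi).

Let hEg : zdefinable_group cE := proj1 hD.
Let hpi : zdefinable_fun cE cG pi := proj2 hD.

(** Each point of [Z] and each point of the kernel of [pi] is definable, being an element of a
    finite definable set. The graph of [mu] is thus a finite union of definable points. *)
Lemma zdefinable_inclusion : zdefinable_fun cZ cE mu.
Proof.
have hEZ := zdefinable_in_setT_prod (proj1 hZ) (proj1 hEg).
have hid := zdefinable_fun_id hEZ.
have hz z : zdefinable_in cZ (fun w => w = z).
  apply: (@zdefinable_in_elem _ _ _ _ _ (enum Z)); rewrite ?mem_enum //.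
    exact: proj1 hZ.
  by apply: zdefinable_in_ext (proj1 hZ) => w; rewrite mem_enum.
have hmu z : zdefinable_in cE (fun g => g = mu z).
  apply: (@zdefinable_in_elem _ _ _ _ _ [seq mu w | w <- enum Z]).
  - exact: proj1 hEg.
  (* The listed values of [mu] are exactly the kernel, the preimage under [pi] of the definable
     point [1]. *)
  - apply: zdefinable_in_ext (zdefinable_in_comp (zdefinable_in1 hG) hpi) => g.
    have [_ _ _ kerP _] := hE; rewrite kerP; split=> [[w <-]|/mapP[w _ ->]].
      by rewrite map_f ?mem_enum.
    by exists w.
  - by rewrite map_f ?mem_enum.
apply: (@zdefinable_fun_graph _ _ _ _ _
  (fun z g => exists2 w, w \in enum Z & z = w /\ g = mu w)) => [z g|].
  by split=> [[w _ [-> ->]]|->] //; exists z; rewrite ?mem_enum.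
apply: zdefinable_in_has => w; apply: zdefinable_in_and.
  exact: zdefinable_in_comp (hz w) (zdefinable_fun_fst hid).
exact: zdefinable_in_comp (hmu w) (zdefinable_fun_snd hid).
Qed.

Lemma zdefinable_section : exists s : G -> E,
  [/\ forall x, pi (s x) = x, s 1 = 1 & zdefinable_fun cG cE s].
Proof.
have [_ _ piS _ _] := hE.
have /choice[m mP] : forall x, exists g,
    pi g = x /\ forall h, pi h = x -> (key cE g <= key cE h)%O.
  move=> x; have [g gx] := piS x.
  (* The fibre over [x] is the list of translates of one of its points by the finite group [Z], so
     it has a least element. *)
  have fibP h : h \in [seq mu z * g | z <- enum Z] <-> pi h = x.
    split=> [/mapP[z _ ->]|hx].
      by case: hE => -[_ ->] *; rewrite (extension_pi_mu hE) mul1g.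
    have [|z <-] := @extension_fiber _ _ _ _ _ hE h g; first by rewrite hx.
    by apply/mapP; exists z; rewrite ?mem_enum.
  have [m /fibP mx mmin] := exists_minimum (key cE) (proj2 (fibP g) gx).
  by exists m; split=> // h /fibP/mmin.
(* The least element of the kernel may differ from [1], so the value at [1] is prescribed separately
   to normalize the cocycle. *)
pose s x := if x == 1 then 1 else m x.
have s1 : s 1 = 1 by rewrite /s eqxx.
have sK x : pi (s x) = x.
  by rewrite /s; case: eqP => [->|_]; [exact: extension_pi1 hE|case: (mP x)].
exists s; split=> //; apply: (@zdefinable_fun_graph _ _ _ _ _ (fun x g =>
   x = 1 /\ g = 1 \/ ~ x = 1 /\ pi g = x /\
   ~ exists h, pi h = x /\ (key cE h < key cE g)%O)) => [x g|].
  split=> [[[-> ->] //|[x1 [gx gmin]]]|->].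
    rewrite /s; move/eqP/negbTE: x1 => ->; have [mx mmin] := mP x.
    apply: (@key_inj _ _ _ _ cE); apply/eqP; rewrite eq_le mmin // andbT leNgt.
    by apply/negP => h; apply: gmin; exists (m x).
  have [->|/[dup]/negbTE x1 /eqP x1'] := eqVneq x 1; first by left.
  right; split=> //; split=> // -[h [/(proj2 (mP x))]].
  by rewrite /s x1 leNgt => /negP.
have hGE := zdefinable_in_setT_prod (proj1 hG) (proj1 hEg).
have hid := zdefinable_fun_id hGE.
(* This identity acts on triples [((x, g), h)], where [h] is the competitor in the fibre that
   minimality of [g] excludes. *)
have hid' := zdefinable_fun_id (zdefinable_in_setT_prod hGE (proj1 hEg)).
have hx1 := zdefinable_in_comp (zdefinable_in1 hG) (zdefinable_fun_fst hid).
apply: zdefinable_in_or; apply: zdefinable_in_and.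
- exact: hx1.
- exact: zdefinable_in_comp (zdefinable_in1 hEg) (zdefinable_fun_snd hid).
- exact: zdefinable_in_not.
- apply: zdefinable_in_and.
    exact: zdefinable_in_eq (zdefinable_fun_comp hpi (zdefinable_fun_snd hid))
                            (zdefinable_fun_fst hid).
  apply: zdefinable_in_not => //.
  apply: zdefinable_in_ex; apply: zdefinable_in_and.
    exact: zdefinable_in_eq (zdefinable_fun_comp hpi (zdefinable_fun_snd hid'))
             (zdefinable_fun_fst (zdefinable_fun_fst hid')).
  exact: zdefinable_in_lt (zdefinable_fun_snd hid')
           (zdefinable_fun_snd (zdefinable_fun_fst hid')).
Qed.

(** This serves both claims of the theorem: it is applied to the definable copy in the equivalence,
    and to the given extension for the definable isomorphism. *)
Lemma zdefinable_extension_twisted : exists f : cocycle G Z,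
  zdefinable_cocycle cG cZ f /\
  exists2 gamma : E -> twisted f,
    equivalence mu pi (twisted_in f) (twisted_pr (f := f)) gamma &
    zdefinable_fun cE (twisted_coding cG cZ f) gamma.
Proof.
have [s [sK s1 hs]] := zdefinable_section.
have [f fE] := section_cocycle hE sK s1.
have [gamma gammaE gammaP] := section_equivalence hE sK s1 fE.
have hGG := zdefinable_in_setT_prod (proj1 hG) (proj1 hG).
have hmu := zdefinable_inclusion.
exists f; split.
  (* The equation relating [f] to the section determines [z] because [mu] is injective. *)
  apply: (@zdefinable_fun_graph _ _ _ _ _ (fun p z =>
    mu z * s (p.1 * p.2) = s p.1 * s p.2)) => [[x y] z /=|].
    have [_ mu_inj _ _ _] := hE.
    by split=> [|->] //; rewrite -fE => /mulIg/mu_inj.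
  have hid := zdefinable_fun_id (zdefinable_in_setT_prod hGG (proj1 hZ)).
  have hx := zdefinable_fun_fst (zdefinable_fun_fst hid).
  have hy := zdefinable_fun_snd (zdefinable_fun_fst hid).
  apply: zdefinable_in_eq.
    apply: (zdefinable_fun_law hEg).
      exact: zdefinable_fun_comp hmu (zdefinable_fun_snd hid).
    exact: zdefinable_fun_comp hs (zdefinable_fun_law hG hx hy).
  exact: (zdefinable_fun_law hEg (zdefinable_fun_comp hs hx)
                                 (zdefinable_fun_comp hs hy)).
exists gamma => //; apply: (@zdefinable_fun_graph _ _ _ _ _
  (fun g (p : twisted f) => mu p.2 * s p.1 = g)) => [g p|].
  by rewrite gammaP.
have hGZ := zdefinable_in_setT_prod (proj1 hG) (proj1 hZ).
have hid := zdefinable_fun_id (zdefinable_in_setT_prod (proj1 hEg) hGZ).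
have hz := zdefinable_fun_snd (zdefinable_fun_snd hid).
have hx := zdefinable_fun_fst (zdefinable_fun_snd hid).
have hmz := zdefinable_fun_comp hmu hz.
exact: zdefinable_in_eq
  (zdefinable_fun_law hEg hmz (zdefinable_fun_comp hs hx)) (zdefinable_fun_fst hid).
Qed.

Lemma twisted_zdefinable_extension (f : cocycle G Z) :
  zdefinable_cocycle cG cZ f ->
  zdefinable_extension cG (twisted_coding cG cZ f) (twisted_pr (f := f)).
Proof.
move=> hf; have hT := zdefinable_in_setT_prod (proj1 hG) (proj1 hZ).
have hid := zdefinable_fun_id (zdefinable_in_setT_prod hT hT).
(* These are the four coordinates of a pair of points [((x, v), (y, w))]; the twisted law is
   composed from them. *)
have hx := zdefinable_fun_fst (zdefinable_fun_fst hid).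
have hy := zdefinable_fun_fst (zdefinable_fun_snd hid).
have hv := zdefinable_fun_snd (zdefinable_fun_fst hid).
have hw := zdefinable_fun_snd (zdefinable_fun_snd hid).
split; last exact: zdefinable_fun_fst (zdefinable_fun_id hT).
split; first exact: hT.
exact: (zdefinable_fun_pair (zdefinable_fun_law hG hx hy) (zdefinable_fun_law hZ
  (zdefinable_fun_law hZ hv hw)
  (zdefinable_fun_comp hf (zdefinable_fun_pair hx hy)))).
Qed.

End DefinableExtensions.

Unset Implicit Arguments.

Theorem lemma2p4 (d : Order.disp_t) (L : language) (M : structure d L)
    (hM : o_minimal M)
    (G : groupType) (cG : coding M G)
    (hG : zdefinable_group cG) (hGconn : definably_connected cG)
    (Z : finZmodType) (cZ : coding M Z) (hZ : zdefinable_zmod cZ)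
    (Gh : groupType) (mu : Z -> Gh) (pi : Gh -> G)
    (hE : central_extension mu pi) :
  (naturally_interpretable cG mu pi <->
   exists f : cocycle G Z,
     zdefinable_cocycle cG cZ f /\
     equivalent mu pi (twisted_in f) (twisted_pr (f := f))) /\
  (forall cGh : coding M Gh,
     zdefinable_extension cG cGh pi ->
     exists f : cocycle G Z,
       zdefinable_cocycle cG cZ f /\
       exists gamma : Gh -> twisted f,
         equivalence mu pi (twisted_in f) (twisted_pr (f := f)) gamma /\
         definable_fun cGh (twisted_coding cG cZ f) gamma).
Proof.
split; first split.
- move=> [E [cE [mu0 [pi0 [hE0 hD eq0]]]]].
  (* The cocycle is built on the definable copy [E], and the equivalence of [Gh] with [E] carries
     the result back. *)
  have [f [hf [gamma gammaE _]]] := zdefinable_extension_twisted hG hZ hE0 hD.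
  by exists f; split=> //; apply: equivalent_trans eq0 _; exists gamma.
- move=> [f [hf eqf]].
  exists (twisted f : groupType), (twisted_coding cG cZ f).
  exists (twisted_in f), (twisted_pr (f := f)); split=> //.
  + exact: twisted_central_extension.
  + exact: twisted_zdefinable_extension.
- move=> cGh hD.
  have [f [hf [gamma gammaE hgamma]]] := zdefinable_extension_twisted hG hZ hE hD.
  (* The isomorphism is even definable without parameters. *)
  by exists f; split=> //; exists gamma; split=> //; apply: definable_zdefinable.
Qed.
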